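(* Let $G$ be a connected bipartite graph which is not regular and has maximum degree $\Delta\geqslant 3$. Then $R(G)\leqslant\sqrt{\Delta-2}$.
   Context: All graphs are simple. For a graph $G$ of order $n$ with adjacency eigenvalues $\lambda_1\geqslant\cdots\geqslant\lambda_n$, the HL-index is $R(G)=\max\{|\lambda_{\lfloor (n+1)/2\rfloor}|,\ |\lambda_{\lceil (n+1)/2\rceil}|\}$. *)

(* Defs.v *)
From HB Require Import structures.
From mathcomp Require Import all_boot all_order all_algebra.
Set Implicit Arguments. Unset Strict Implicit. Unset Printing Implicit Defensive.
Import Order.TTheory GRing.Theory Num.Theory.
Local Open Scope ring_scope.

Definition simple_graph (n : nat) (e : rel 'I_n) : Prop :=
  symmetric e /\ irreflexive e.

Definition adjmx (R : nzRingType) (n : nat) (e : rel 'I_n) : 'M[R]_n :=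
  \matrix_(i < n, j < n) (e i j)%:R.

Definition deg (n : nat) (e : rel 'I_n) (i : 'I_n) : nat := #|[pred j | e i j]|.

Definition maxdeg (n : nat) (e : rel 'I_n) : nat := (\max_(i < n) deg e i)%N.

Definition regular (n : nat) (e : rel 'I_n) : Prop :=
  forall i j : 'I_n, deg e i = deg e j.

Definition connected (n : nat) (e : rel 'I_n) : Prop :=
  forall i j : 'I_n, connect e i j.

Definition bipartite (n : nat) (e : rel 'I_n) : Prop :=
  exists c : 'I_n -> bool, forall i j, e i j -> c i != c j.

(* s is the list of eigenvalues (with multiplicity) of A,
   in non-increasing order: lambda_1 >= ... >= lambda_n, lambda_k = s`_(k-1). *)
Definition eigenvalues_desc (R : rcfType) (n : nat) (A : 'M[R]_n) (s : seq R) : Prop :=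
  sorted (fun x y : R => y <= x) s /\
  char_poly A = \prod_(x <- s) ('X - x%:P).

(* HL-index: max(|lambda_{floor((n+1)/2)}|, |lambda_{ceil((n+1)/2)}|), 1-indexed *)
Definition HL_index (R : rcfType) (n : nat) (s : seq R) : R :=
  Num.max `|s`_((n.+1)./2).-1| `|s`_((n.+2)./2).-1|.

(* Main.v *)
(** Write [k = Delta - 2]. The spectrum of a bipartite graph is symmetric about
    0, so if the HL-index exceeded [sqrt k], every eigenvalue would have square
    larger than [k], and [Q = A^2 - k I] would be positive definite. The
    off-diagonal entries of [Q] count common neighbours and its diagonal entries
    are [deg i - k <= 2]; testing [Q] on vectors with at most four small integer
    entries gives: all degrees are [Delta] or [Delta - 1]; distinct vertices have
    at most one common neighbour, and none if both have degree [Delta - 1]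
    ("low" vertices).
    Let [u] be a low vertex with neighbours [w <> w'], and let [v], [v'] be
    neighbours of [w], [w'] other than [u]. The vector [v + v' - 2u] shows that
    [v] and [v'] have a common neighbour [x]; the vector [y - v - v' + 2u] shows
    that every neighbour [y] of [x] has a common neighbour with [u], and so
    [deg x <= deg u] and [x] is low. Since [w], [w'] are not both low, let [w']
    have degree [Delta]; two choices of [v'] then give two distinct low
    neighbours of [v], which is impossible. *)
Require Import Defs.
From HB Require Import structures.
From mathcomp Require Import all_boot all_order all_algebra.
From mathcomp Require Import complex ring lra zify.
Import Order.TTheory GRing.Theory Num.Theory.
Local Open Scope ring_scope.

(** * Spectral bounds for normal and symmetric matrices *)

Section Spectral.
Local Open Scope sesquilinear_scope.

Lemma dotmx_sum (C : numClosedFieldType) n (v : 'rV[C]_n) :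
  (v *m v^t*) 0 0 = \sum_i `|v 0 i| ^+ 2.
Proof. by rewrite mxE; apply: eq_bigr => i _; rewrite !mxE -normCK. Qed.

(** In a unitary eigenbasis both sides are sums of the squared coordinates [|y 0 i| ^+ 2], weighted
    by [c] on the left and by [|d 0 i| ^+ 2] on the right; one nonzero coordinate makes the
    comparison strict. *)
Lemma normalmx_dot_gt (C : numClosedFieldType) n (A : 'M[C]_n) c :
  A \is normalmx -> (forall a, eigenvalue A a -> c < `|a| ^+ 2) ->
  forall v : 'rV_n, v != 0 ->
  c * (v *m v^t*) 0 0 < ((v *m A) *m (v *m A)^t*) 0 0.
Proof.
move=> /orthomx_spectralP; set P := spectralmx A; set d := spectral_diag A.
move=> Adef Aeig v v0.
have Pu : P \is unitarymx := spectral_unitarymx A.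
have PU : P \in unitmx := spectral_unit A.
have deig i : eigenvalue A (d 0 i).
  apply/eigenvalueP; exists (row i P).
    rewrite {1}Adef !mulmxA -row_mul mulmxV // row1 -rowE.
    by rewrite row_diag_mx -scalemxAl -rowE.
  apply: contraTneq PU => Pi0; rewrite unitmxE (expand_det_row P i).
  rewrite big1 ?unitr0 // => j _.
  by have /rowP/(_ j) := Pi0; rewrite !mxE => ->; rewrite mul0r.
pose y := v *m invmx P.
have vy : v = y *m P by rewrite mulmxKV.
have vA : v *m A = (y *m diag_mx d) *m P by rewrite {1}Adef !mulmxA.
have y0 : y != 0 by apply: contraNneq v0 => y0; rewrite vy y0 mul0mx.
have dotP (z : 'rV_n) : (z *m P) *m (z *m P)^t* = z *m z^t*.
  by rewrite trmx_mul map_mxM mulmxA mulmxtVK.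
rewrite vA dotP vy dotP !dotmx_sum mulr_sumr.
have yd i : (y *m diag_mx d) 0 i = y 0 i * d 0 i.
  by rewrite mul_mx_diag mxE.
have /rV0Pn[i yi0] := y0.
rewrite (bigD1 i) //= [ltRHS](bigD1 i) //= ltr_leD //.
  rewrite yd normrM exprMn mulrC ltr_pM2l ?Aeig //.
  by rewrite exprn_gt0 // normr_gt0.
apply: ler_sum => j _; rewrite yd normrM exprMn mulrC ler_wpM2l ?exprn_ge0 //.
exact/ltW/Aeig.
Qed.

(** Over the complex extension of [R] a real symmetric matrix becomes normal and its eigenvalues are
    still the entries of [s], so the complex bound descends to [R]. *)
Lemma symmx_dot_gt (R : rcfType) n (A : 'M[R]_n) (s : seq R) c :
  A^T = A -> char_poly A = \prod_(x <- s) ('X - x%:P) ->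
  {in s, forall x, c < x ^+ 2} ->
  forall v : 'rV_n, v != 0 ->
  c * (v *m v^T) 0 0 < (v *m (A *m A) *m v^T) 0 0.
Proof.
move=> Asym Achar sc v v0.
pose f := real_complex R.
have fconj m p (M : 'M[R]_(m, p)) : (map_mx f M)^t* = map_mx f M^T.
  by apply/matrixP => i j; rewrite !mxE; apply/CrealP/complex_realP; 
  exists (M j i).
have Bsym : (map_mx f A) \is normalmx.
  by apply/normalmxP; rewrite fconj Asym.
have Beig a : eigenvalue (map_mx f A) a -> f c < `|a| ^+ 2.
  rewrite eigenvalue_root_char -map_char_poly Achar map_prod_XsubC.
  rewrite -(big_map f predT (fun x => 'X - x%:P)) root_prod_XsubC.
  move=> /mapP[x xs ->]; rewrite real_normK; last first.
    by apply/complex_realP; exists x.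
  by rewrite -rmorphXn /= ltcR sc.
have fv0 : map_mx f v != 0.
  apply: contraNneq v0 => /rowP fv; apply/eqP/rowP => i.
  by have := fv i; rewrite !mxE => /complexI.
have := @normalmx_dot_gt _ _ _ _ Bsym Beig _ fv0.
rewrite -map_mxM !fconj -!map_mxM [X in _ * X < _]mxE [X in _ < X]mxE.
by rewrite -rmorphM ltcR trmx_mul Asym !mulmxA.
Qed.

End Spectral.

(** * Symmetry of a bipartite spectrum and its median eigenvalues *)

Lemma char_poly_opp (R : idomainType) n (A : 'M[R]_n) (s : seq R) :
  char_poly A = \prod_(x <- s) ('X - x%:P) ->
  char_poly (- A) = \prod_(x <- map -%R s) ('X - x%:P).
Proof.
move=> Achar.
have sz : size s = n.
  by have := size_char_poly A; rewrite Achar size_prod_XsubC => -[].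
(* [det (X + A) = (-1)^n det (-X - A)], and substituting [- 'X] is a ring morphism, so it commutes
   with the determinant. *)
have -> : char_poly (- A) = (-1) ^+ n * (char_poly A \Po - 'X).
  rewrite /char_poly -[RHS]/(_ * (comp_poly (- 'X) _)) -det_map_mx -detZ.
  apply: (congr1 determinant). apply/matrixP => i j. rewrite !mxE.
  by rewrite rmorphB rmorphMn /= comp_polyX comp_polyC polyCN mulN1r opprB
    mulNrn !opprK addrC.
rewrite Achar rmorph_prod /= big_map -{n A Achar}sz.
elim: s => [|x s IHs]; first by rewrite !big_nil mulr1.
rewrite !big_cons exprS mulrACA IHs.
by rewrite comp_polyB comp_polyX comp_polyC polyCN mulN1r opprB !opprK addrC.
Qed.

(** Conjugation by the diagonal matrix of signs [(-1) ^+ c i] negates the entries between the two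
    colour classes; all other entries are zero. *)
Lemma char_poly_bipartite (R : idomainType) n (e : rel 'I_n) :
  bipartite e -> char_poly (- adjmx R e) = char_poly (adjmx R e).
Proof.
case=> c ec; pose D : 'M[{poly R}]_n := diag_mx (\row_i (-1) ^+ c i).
rewrite /char_poly.
have -> : char_poly_mx (- adjmx R e) = D *m char_poly_mx (adjmx R e) *m D.
  apply/matrixP => i j; rewrite mul_mx_diag mul_diag_mx !mxE.
  rewrite mulrAC -signr_addb.
  have [->|ij] := eqVneq i j.
    rewrite addbb mul1r; case: (boolP (e j j)) => [/ec|_]; rewrite ?eqxx //.
    by rewrite oppr0.
  rewrite !sub0r; case: (boolP (e i j)) => [/ec|_].
    by rewrite -negb_add negbK => ->; rewrite polyCN mulN1r.
  by rewrite oppr0 polyC0 oppr0 mulr0.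
rewrite !det_mulmx mulrAC -det_mulmx.
suff -> : D *m D = 1%:M by rewrite det1 mul1r.
rewrite mulmx_diag; apply/matrixP => i j; rewrite !mxE -signr_addb addbb.
by [].
Qed.

(** Such a list equals its reversed negation, so its two median entries are opposite. Entries up to
    the first median then exceed [t], and those from the second on lie below [- t]. *)
Lemma HL_index_lt (R : rcfType) (n : nat) (s : seq R) (t : R) :
  sorted (fun x y : R => y <= x) s -> perm_eq (map -%R s) s -> size s = n ->
  0 <= t -> t < HL_index n s -> {in s, forall x, t < `|x|}.
Proof.
move=> s_sorted s_sym sz t0 t_lt x /(nthP 0) [j js <-{x}].
have s_rev : rev (map -%R s) = s.
  apply: (@sorted_eq _ (fun x y : R => y <= x)) => //.
  - by move=> x y z /= yx xz; apply: le_trans xz yx.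
  - by move=> x y /= /andP[xy yx]; apply: le_anti; rewrite yx.
  - rewrite rev_sorted sorted_map; apply: sub_sorted s_sorted => x y /=.
    by rewrite lerN2.
  - by rewrite perm_rev.
have s_anti i : (i < n)%N -> s`_i = - s`_(n.-1 - i).
  move=> ilt; rewrite -{1}s_rev nth_rev size_map sz //.
  by rewrite (nth_map 0) ?sz; [congr (- _`_ _); lia | lia].
have s_mono i l : (i <= l)%N -> (l < n)%N -> s`_l <= s`_i.
  move=> il ln.
  apply: (@sorted_leq_nth _ (fun x y : R => y <= x)) => //; rewrite ?inE ?sz //.
    by move=> x y z /= yx xz; apply: le_trans xz yx.
  lia.
(* Counted from 0, the median positions [p] and [q] are equal or adjacent, and reversal exchanges
   them. *)
move: t_lt; rewrite /HL_index; set p := (n.+1)./2.-1; set q := (n.+2)./2.-1.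
have n0 : (0 < n)%N by rewrite -sz; apply: leq_ltn_trans js.
have pq : (p <= q)%N by rewrite /p /q; lia.
have qp : (q <= p.+1)%N by rewrite /p /q; lia.
have qE : q = (n.-1 - p)%N by rewrite /p /q; lia.
have qn : (q < n)%N by lia.
have spq : s`_p = - s`_q by rewrite qE s_anti //; lia.
have := s_mono _ _ pq qn; rewrite spq normrN maxxx => sq_le t_lt.
have {sq_le} sq0 : s`_q <= 0 by lra.
rewrite ler0_norm // in t_lt.
have [jp|pj] := leqP j p.
  have := s_mono _ _ jp (leq_ltn_trans pq qn); rewrite spq => sj.
  by rewrite ger0_norm; lra.
have qj : (q <= j)%N by lia.
have jn : (j < n)%N by rewrite -sz.
have sj := s_mono _ _ qj jn.
by rewrite ler0_norm; lra.
Qed.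

Lemma spectral_gap (R : rcfType) n (e : rel 'I_n) (s : seq R) k :
  symmetric e -> bipartite e -> eigenvalues_desc (adjmx R e) s ->
  Num.sqrt k%:R < HL_index n s ->
  forall v : 'rV_n, v != 0 ->
  k%:R * (v *m v^T) 0 0 < (v *m (adjmx R e *m adjmx R e) *m v^T) 0 0.
Proof.
move=> e_sym e_bip [s_sorted s_char] s_HL.
have s_sym : perm_eq (map -%R s) s.
  apply: prod_XsubC_eq; rewrite -s_char -(char_poly_bipartite _ _ _ e_bip).
  by rewrite (char_poly_opp _ _ _ _ s_char).
have sz : size s = n.
  by have := size_char_poly (adjmx R e); rewrite s_char size_prod_XsubC => -[].
have s_lt := HL_index_lt _ _ _ _ s_sorted s_sym sz (sqrtr_ge0 _) s_HL.
apply: symmx_dot_gt s_char _; first by apply/matrixP => i j; rewrite !mxE e_sym.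
move=> x /s_lt; rewrite -sqrtr_sqr => x_lt.
rewrite -ltr_sqrt //; case: ltrgtP (sqr_ge0 x) => // x0 _.
by move: x_lt; rewrite -x0 sqrtr0 ltNge sqrtr_ge0.
Qed.

(** * Common neighbours and the integer quadratic form *)

Definition nbrs (n : nat) (e : rel 'I_n) (i : 'I_n) : {set 'I_n} :=
  [set j | e i j].

Definition codeg (n : nat) (e : rel 'I_n) (i j : 'I_n) : nat :=
  #|nbrs n e i :&: nbrs n e j|.

(** This is [A^2 - k I]. Integer entries let [lia] settle each positivity test. *)
Definition gap_form (n : nat) (e : rel 'I_n) (k : nat) : 'M[int]_n :=
  \matrix_(i, j) (codeg n e i j)%:Z - (k%:Z)%:M.

Definition posdef (n : nat) (Q : 'M[int]_n) : Prop :=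
  forall v : 'rV_n, v != 0 -> 0 < (v *m Q *m v^T) 0 0.

Lemma codegC n (e : rel 'I_n) i j : codeg n e i j = codeg n e j i.
Proof. by rewrite /codeg setIC. Qed.

Lemma codegii n (e : rel 'I_n) i : codeg n e i i = deg e i.
Proof. by rewrite /codeg setIid cardsE. Qed.

Lemma codeg_gt0 n (e : rel 'I_n) i j w :
  e i w -> e j w -> (0 < codeg n e i j)%N.
Proof. by move=> iw jw; apply/card_gt0P; exists w; rewrite !inE iw. Qed.

Lemma codeg_gt1 n (e : rel 'I_n) i j w w' :
  w != w' -> e i w -> e j w -> e i w' -> e j w' -> (1 < codeg n e i j)%N.
Proof.
move=> ww' iw jw iw' jw'; apply/card_gt1P; exists w, w'.
by rewrite !inE iw jw iw' jw'.
Qed.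

Lemma adjmx_sqr (R : nzRingType) n (e : rel 'I_n) i j :
  symmetric e -> (adjmx R e *m adjmx R e) i j = (codeg n e i j)%:R.
Proof.
move=> e_sym; rewrite mxE /codeg -sum1_card natr_sum [RHS]big_mkcond /=.
apply: eq_bigr => w _; rewrite !mxE !inE (e_sym j w) -natrM mulnb.
by case: (_ && _).
Qed.

Lemma gap_form_posdef (R : realFieldType) n (e : rel 'I_n) k :
  symmetric e ->
  (forall v : 'rV[R]_n, v != 0 ->
     k%:R * (v *m v^T) 0 0 < (v *m (adjmx R e *m adjmx R e) *m v^T) 0 0) ->
  posdef n (gap_form n e k).
Proof.
move=> e_sym gap v v0; pose f := (intr : int -> R).
have fv0 : map_mx f v != 0.
  apply: contraNneq v0 => /rowP fv; apply/eqP/rowP => i.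
  by have /eqP := fv i; rewrite !mxE intr_eq0 => /eqP.
have := gap _ fv0; rewrite -subr_gt0.
have -> : adjmx R e *m adjmx R e = map_mx f (\matrix_(i, j) (codeg n e i j)%:Z).
  by apply/matrixP => i j; rewrite adjmx_sqr // !mxE.
rewrite map_trmx -!map_mxM [X in X - _]mxE [X in _ - _ * X]mxE.
rewrite -[k%:R]/(f k%:Z) -rmorphM -rmorphB ltr0z /=.
rewrite /gap_form mulmxBr mul_mx_scalar mulmxBl -scalemxAl.
rewrite [X in _ -> 0 < X]mxE [X in _ -> 0 < _ + X]mxE.
by rewrite [X in _ -> 0 < _ - X]mxE.
Qed.

(** Positivity at [a e_i + b e_j + c e_k + d e_l]. Indices may repeat, so spare slots take a
    repeated index with coefficient 0; the last premise says that coordinate [i] of the vector is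
    nonzero. *)
Lemma posdef_comb n (Q : 'M[int]_n) (i j k l : 'I_n) (a b c d : int) :
  Q^T = Q -> posdef n Q ->
  a + b *+ (i == j) + c *+ (i == k) + d *+ (i == l) != 0 ->
  0 < a * a * Q i i + b * b * Q j j + c * c * Q k k + d * d * Q l l
      + 2 * (a * b * Q i j + a * c * Q i k + a * d * Q i l
             + b * c * Q j k + b * d * Q j l + c * d * Q k l).
Proof.
move=> Qsym Qpos a0.
have Qs x y : Q y x = Q x y by rewrite -{1}Qsym mxE.
pose D x : 'rV[int]_n := delta_mx 0 x.
have QD x y : (D x *m Q *m (D y)^T) 0 0 = Q x y.
  by rewrite trmx_delta -rowE -colE !mxE.
pose B (x y : 'rV_n) := (x *m Q *m y^T) 0 0.
have BDl x y z : B (x + y) z = B x z + B y z by rewrite /B !mulmxDl mxE.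
have BDr x y z : B z (x + y) = B z x + B z y.
  by rewrite /B linearD mulmxDr mxE.
have BZl t x y : B (t *: x) y = t * B x y by rewrite /B -!scalemxAl mxE.
have BZr t x y : B x (t *: y) = t * B x y.
  by rewrite /B linearZ /= -scalemxAr mxE.
have BD x y : B (D x) (D y) = Q x y by exact: QD.
pose v := a *: D i + b *: D j + c *: D k + d *: D l.
have v0 : v != 0.
  apply: contraNneq a0 => /rowP/(_ i); rewrite !mxE !eqxx /= mulr1.
  by rewrite ![_ * (nat_of_bool _)%:R]mulr_natr => ->.
have := Qpos v v0; rewrite -/(B v v) /v !(BDl, BDr, BZl, BZr, BD).
rewrite (Qs i j) (Qs i k) (Qs i l) (Qs j k) (Qs j l) (Qs k l) => pos.
by apply: lt_le_trans pos _; rewrite le_eqVlt; apply/orP; left; apply/eqP; ring.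
Qed.

(** * Combinatorics around a low vertex *)

Lemma gap_form_not_posdef n (e : rel 'I_n) (k : nat) (u : 'I_n) :
  symmetric e -> (0 < k)%N -> (forall i, deg e i <= k.+2)%N ->
  (deg e u <= k.+1)%N -> ~ posdef n (gap_form n e k).
Proof.
move=> e_sym k0 deg_le u_low Qpos.
pose c := codeg n e; set Q := gap_form n e k in Qpos.
have Qii i : Q i i = (deg e i)%:Z - k%:Z by rewrite !mxE eqxx codegii mulr1n.
have Qij i j : i != j -> Q i j = (c i j)%:Z.
  by move=> ij; rewrite !mxE (negPf ij) subr0.
have Qsym : Q^T = Q by apply/matrixP => i j; rewrite !mxE codegC (eq_sym j).
have cC i j : c i j = c j i := codegC n e i j.
have deg_gt i : (k < deg e i)%N.
  have := posdef_comb n Q i i i i 1 0 0 0 Qsym Qpos.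
  by rewrite eqxx Qii => /(_ isT); lia.
(* At [e_i - e_j] the form is at most [4 - 2 * c i j]; for two low vertices, at most
   [2 - 2 * c i j]. *)
have c_le1 i j : i != j -> (c i j <= 1)%N.
  move=> ij; have := posdef_comb n Q i j j j 1 (-1) 0 0 Qsym Qpos.
  rewrite (negPf ij) => /(_ isT); rewrite !Qii (Qij _ _ ij).
  by have := deg_le i; have := deg_le j; lia.
have c_low i j : i != j -> (deg e i <= k.+1)%N -> (deg e j <= k.+1)%N ->
    c i j = 0%N.
  move=> ij di dj; have := posdef_comb n Q i j j j 1 (-1) 0 0 Qsym Qpos.
  rewrite (negPf ij) => /(_ isT); rewrite !Qii (Qij _ _ ij).
  lia.
(* As [Q u u <= 1], the form at [v + v' - 2u] is at most [8 - 4 * (c u v + c u v') + 2 * c v v'],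
   hence at most [2 * c v v']. *)
have c_pair v v' : u != v -> u != v' -> v != v' ->
    (0 < c u v)%N -> (0 < c u v')%N -> (0 < c v v')%N.
  move=> uv uv' vv' cv cv'.
  have := posdef_comb n Q u v v' v' (-2) 1 1 0 Qsym Qpos.
  rewrite (negPf uv) (negPf uv') => /(_ isT).
  rewrite !Qii (Qij _ _ uv) (Qij _ _ uv') (Qij _ _ vv').
  by have := deg_le v; have := deg_le v'; lia.
(* Here [x] stands for the vertex [y] of the overview. The form at [x - v - v' + 2u] is at most
   [10 - 4 + 2 - 8 + 4 * c x u], that is [4 * c x u]. *)
have c_third v v' x : u != v -> u != v' -> v != v' ->
    x != u -> x != v -> x != v' ->
    (0 < c u v)%N -> (0 < c u v')%N -> (0 < c x v)%N -> (0 < c x v')%N ->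
    (0 < c x u)%N.
  move=> uv uv' vv' xu xv xv' cv cv' cxv cxv'.
  have := posdef_comb n Q x v v' u 1 (-1) (-1) 2 Qsym Qpos.
  rewrite (negPf xu) (negPf xv) (negPf xv') => /(_ isT).
  have := c_le1 _ _ vv'.
  have vu : v != u by rewrite eq_sym.
  have v'u : v' != u by rewrite eq_sym.
  rewrite !Qii (Qij _ _ xv) (Qij _ _ xv') (Qij _ _ xu).
  rewrite (Qij _ _ vv') (Qij _ _ vu) (Qij _ _ v'u).
  rewrite (cC v u) (cC v' u).
  by have := deg_le v; have := deg_le v'; have := deg_le x; lia.
have c_le1_eq i j w w' : i != j -> e i w -> e j w -> e i w' -> e j w' -> w = w'.
  move=> ij iw jw iw' jw'; apply/eqP; apply: contraTT (c_le1 _ _ ij) => ww'.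
  by rewrite -ltnNge; apply: codeg_gt1 ww' _ _ _ _.
have low_nbr w w' v v' : w != w' -> e u w -> e u w' -> e w v -> e w' v' ->
    u != v -> u != v' ->
    exists w'', [/\ e w'' v, e w'' v' & (deg e w'' <= k.+1)%N].
  move=> ww' uw uw' wv w'v' uv uv'.
  have cv : (0 < c u v)%N.
    by apply: (codeg_gt0 _ _ _ _ w) => //; rewrite e_sym.
  have cv' : (0 < c u v')%N.
    by apply: (codeg_gt0 _ _ _ _ w') => //; rewrite e_sym.
  have vv' : v != v'.
    apply: contraNneq ww' => vv'; apply/eqP.
    by apply: (c_le1_eq u v) => //; rewrite e_sym // vv'.
  have /card_gt0P[x] := c_pair _ _ uv uv' vv' cv cv'.
  rewrite !inE => /andP[vx v'x].
  (* Otherwise [x] would be the only common neighbour of [u] and [v], and also of [u] and [v'],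
     forcing [w = x = w']. *)
  have ux : ~~ e u x.
    apply: contraNN ww' => ux; apply/eqP.
    have -> : w = x by apply: (c_le1_eq u v) => //; rewrite e_sym.
    by apply: (c_le1_eq u v') => //; rewrite e_sym.
  exists x; rewrite !(e_sym x); split=> //.
  have cxu y : e x y -> (0 < c y u)%N.
    move=> xy.
    have yu : y != u by apply: contraNneq ux => <-; rewrite e_sym.
    have [->|yv] := eqVneq y v; first by rewrite cC.
    have [->|yv'] := eqVneq y v'; first by rewrite cC.
    apply: (c_third v v') => //.
      by apply: (codeg_gt0 _ _ _ _ x) => //; rewrite e_sym.
    by apply: (codeg_gt0 _ _ _ _ x) => //; rewrite e_sym.
  (* [g] maps the neighbours of [x] into those of [u]; the default [u] is never reached on them. It
     is injective because [x] and [g y] are distinct and share only [y]. *)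
  pose g y := odflt u [pick z in nbrs n e y :&: nbrs n e u].
  have gP y : e x y -> e y (g y) /\ e u (g y).
    move=> xy; rewrite /g; case: pickP => [z|no].
      by rewrite !inE => /andP[].
    by have /card_gt0P[z zin] := cxu _ xy; have := no z; rewrite /= zin.
  rewrite (leq_trans _ u_low) // -[deg e x]cardsE -[deg e u]cardsE.
  rewrite -(@card_in_imset _ _ g); last first.
    move=> y y'; rewrite !inE => xy xy' gyy'.
    have [yg ug] := gP _ xy; have [y'g' _] := gP _ xy'; rewrite -gyy' in y'g'.
    apply: (c_le1_eq x (g y)) => //; rewrite 1?e_sym //.
    by apply: contraNneq ux => ->.
  apply/subset_leq_card/subsetP => z /imsetP[y]; rewrite inE => xy ->.
  by have [_] := gP _ xy; rewrite inE.
(* Two low neighbours of [u] would share [u], so one of any two has full degree [k.+2 >= 3] and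
   keeps two neighbours besides [u]. *)
have [w [w' [ww' uw uw' dw']]] :
    exists w w', [/\ w != w', e u w, e u w' & (k.+2 <= deg e w')%N].
  have /card_gt1P[w [w' [uw uw' ww']]] : (1 < deg e u)%N.
    by have := deg_gt u; lia.
  rewrite !inE in uw uw'.
  have [dw'|dw'] := leqP k.+2 (deg e w'); first by exists w, w'.
  have [dw|dw] := leqP k.+2 (deg e w); first by exists w', w; rewrite eq_sym.
  have := c_low _ _ ww' dw dw'; have := codeg_gt0 n e w w' u.
  by rewrite !(e_sym _ u) /c => /(_ uw uw'); lia.
have nbr_neq y m : (m.+1 < deg e y)%N -> (m < #|nbrs n e y :\ u|)%N.
  have dE : #|nbrs n e y| = deg e y := cardsE _.
  by rewrite -dE (cardsD1 u); move: (#|_ :\ u|) (u \in _) => N []; lia.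
have /card_gt0P[v] : (0 < #|nbrs n e w :\ u|)%N.
  by apply: nbr_neq; have := deg_gt w; lia.
rewrite !inE eq_sym => /andP[uv wv].
have /card_gt1P[v1 [v2 []]] : (1 < #|nbrs n e w' :\ u|)%N.
  by apply: nbr_neq; lia.
rewrite !inE ![_ == u]eq_sym => /andP[uv1 wv1] /andP[uv2 wv2] v12.
have [x1 [x1v x1v1 dx1]] := low_nbr _ _ _ _ ww' uw uw' wv wv1 uv uv1.
have [x2 [x2v x2v2 dx2]] := low_nbr _ _ _ _ ww' uw uw' wv wv2 uv uv2.
(* If they were equal, [x1] and [w'] would share both [v1] and [v2]; and [x1 = w'] would make [w]
   and [w'] common neighbours of [u] and [v]. *)
have x12 : x1 != x2.
  apply: contraNneq v12 => x12; rewrite -x12 in x2v2.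
  have x1w' : x1 != w'.
    apply: contraNneq ww' => x1w'; rewrite x1w' in x1v; apply/eqP.
    by apply: (c_le1_eq u v) => //; rewrite e_sym.
  by apply/eqP; apply: (c_le1_eq x1 w').
have := c_low _ _ x12 dx1 dx2; have := codeg_gt0 n e x1 x2 v x1v x2v.
by rewrite -/(c _ _) => + c0; rewrite c0.
Qed.

Theorem theorem2p3 (R : rcfType) (n : nat) (e : rel 'I_n) (s : seq R) :
  simple_graph e -> connected e -> bipartite e -> ~ regular e ->
  (3 <= maxdeg e)%N ->
  eigenvalues_desc (adjmx R e) s ->
  HL_index n s <= Num.sqrt ((maxdeg e - 2)%:R).
Proof.
move=> [e_sym _] _ e_bip e_irr deg3 e_spec; rewrite leNgt; apply/negP => s_HL.
have deg_le i : (deg e i <= maxdeg e)%N by apply: leq_bigmax.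
have [u u_low] : exists u, (deg e u < maxdeg e)%N.
  apply/existsP; apply: contraPT (e_irr) => /existsPn all_max; apply.
  have degE i : deg e i = maxdeg e.
    by apply/eqP; rewrite eqn_leq deg_le leqNgt all_max.
  by move=> i j; rewrite !degE.
have gap := spectral_gap _ _ _ _ (maxdeg e - 2)%N e_sym e_bip e_spec s_HL.
apply: (gap_form_not_posdef _ _ _ u) (gap_form_posdef _ _ _ _ e_sym gap) => //.
- by rewrite subn_gt0.
- by move=> i; have := deg_le i; lia.
- by move: u_low deg3; lia.
Qed.
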